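(* Let $(X,\mathcal U)$ be a (Hausdorff) non-archimedean uniform space and let $G$ be one of the groups $F^b_{NA}(X,\mathcal U)$, $A_{NA}(X,\mathcal U)$, $B_{NA}(X,\mathcal U)$. Then: (1) $\chi(G)=w(\mathcal U)$ and $w(G)=w(\mathcal U)\cdot l(\mathcal U)$; (2) if $\mathcal U$ is induced by an ultra-metric $d$ on $X$, then $G$ is an ultra-normable topological group (its topology is induced by an ultra-norm) and $w(G)=w(X)$, the topological weight of $X$.
   Context: All spaces and groups are Hausdorff; all cardinal invariants are taken to be infinite. A uniform space is non-archimedean if its uniformity has a base of equivalence relations. A topological group is non-archimedean ($\mathbf{NA}$) if it has a local base at the identity of open subgroups; it is balanced if its left and right uniformities coincide. For a class $\Omega$ of topological groups, the $\Omega$-free topological group of a uniform space $(X,\mathcal U)$ is a group $F_\Omega\in\Omega$ with a uniformly continuous map $i\colon X\to F_\Omega$ (with respect to the two-sided uniformity of $F_\Omega$) such that every uniformly continuous map $\varphi\colon X\to P$ into a group $P\in\Omega$ equals $\Phi\circ i$ for a unique continuous homomorphism $\Phi\colon F_\Omega\to P$. $F^b_{NA}$, $A_{NA}$, $B_{NA}$ denote the $\Omega$-free groups for $\Omega$ = balanced $\mathbf{NA}$ groups, abelian $\mathbf{NA}$ groups, Boolean $\mathbf{NA}$ groups (groups in which every non-identity element has order 2), respectively. $w(\mathcal U)$ is the minimal cardinality of a base of $\mathcal U$; $l(\mathcal U)$ is the minimal infinite cardinal $\kappa$ such that for every entourage $\varepsilon\in\mathcal U$ there is $A\subseteq X$ with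 $|A|\le\kappa$ and $\varepsilon(A)=X$. $\chi(G)$ is the character and $w(G)$ the weight of $G$. An ultra-norm on a group is a function $p\ge0$ with $p(e)=0$, $p(x^{-1})=p(x)$, $p(xy)\le\max\{p(x),p(y)\}$ and $p(x)=0\Rightarrow x=e$. *)

(* Defs.v *)
From HB Require Import structures.
From mathcomp Require Import all_boot all_order all_algebra.
From mathcomp Require Import all_classical all_reals topology.
Set Implicit Arguments. Unset Strict Implicit. Unset Printing Implicit Defensive.
Import Order.TTheory GRing.Theory Num.Theory.
Local Open Scope classical_set_scope.
Local Open Scope ring_scope.

Record topGroup : Type := TopGroup {
  tg_car :> topologicalType;
  tg_mul : tg_car -> tg_car -> tg_car;
  tg_inv : tg_car -> tg_car;
  tg_one : tg_car;
  tg_mulA : forall x y z, tg_mul x (tg_mul y z) = tg_mul (tg_mul x y) z;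
  tg_mul1g : forall x, tg_mul tg_one x = x;
  tg_mulVg : forall x, tg_mul (tg_inv x) x = tg_one;
  tg_mul_cont : continuous (fun p : tg_car * tg_car => tg_mul p.1 p.2);
  tg_inv_cont : continuous tg_inv }.

Section TopGroupDefs.
Variable G : topGroup.
Local Notation "x * y" := (tg_mul x y).
Local Notation "x ^-1" := (tg_inv x).
Local Notation e := (tg_one G).

Definition is_subgroup (H : set G) :=
  H e /\ (forall x y, H x -> H y -> H (x * y)) /\ (forall x, H x -> H (x^-1)).

Definition tg_NA := forall U, nbhs e U ->
  exists H : set G, [/\ open H, is_subgroup H & H `<=` U].

(** balanced: left and right uniformities coincide
    (left entourages {(x,y) | x^-1 y \in V}, right ones {(x,y) | y x^-1 \in V}) *)
Definition tg_balanced :=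
  (forall U, nbhs e U -> exists2 V, nbhs e V &
      forall x y, V (y * x^-1) -> U (x^-1 * y)) /\
  (forall U, nbhs e U -> exists2 V, nbhs e V &
      forall x y, V (x^-1 * y) -> U (y * x^-1)).

Definition tg_abelian := forall x y : G, x * y = y * x.

Definition tg_boolean := forall x : G, x <> e -> x * x = e.

Definition ultra_norm (R : realType) (p : G -> R) :=
  [/\ (forall x, 0 <= p x), p e = 0, (forall x, p (x^-1) = p x),
      (forall x y, p (x * y) <= Num.max (p x) (p y)) &
      (forall x, p x = 0 -> x = e)].

Definition norm_induces_topology (R : realType) (p : G -> R) :=
  forall (g : G) (A : set G),
    nbhs g A <-> exists2 r : R, 0 < r & forall h, p (g^-1 * h) < r -> A h.

Definition ultra_normable (R : realType) :=
  exists p : G -> R, ultra_norm p /\ norm_induces_topology p.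
End TopGroupDefs.

Inductive NAclass := NA_balanced | NA_abelian | NA_boolean.

Definition in_class (c : NAclass) (P : topGroup) :=
  hausdorff_space P /\ tg_NA P /\
  match c with
  | NA_balanced => tg_balanced P
  | NA_abelian => tg_abelian P
  | NA_boolean => tg_boolean P
  end.

Definition unif_cont_2s (X : uniformType) (P : topGroup) (f : X -> P) :=
  forall V, nbhs (tg_one P) V -> exists2 E, entourage E &
    forall x y, E (x, y) ->
      V (tg_mul (tg_inv (f x)) (f y)) /\ V (tg_mul (f y) (tg_inv (f x))).

Definition cont_hom (G P : topGroup) (F : G -> P) :=
  continuous F /\ forall x y, F (tg_mul x y) = tg_mul (F x) (F y).

Definition is_free_group (c : NAclass) (X : uniformType) (G : topGroup)
    (i : X -> G) :=
  in_class c G /\ unif_cont_2s i /\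
  forall P : topGroup, in_class c P ->
    forall phi : X -> P, unif_cont_2s phi ->
      exists F : G -> P, [/\ cont_hom F, phi = F \o i &
        forall F' : G -> P, cont_hom F' -> phi = F' \o i -> F' = F].

Definition equiv_entourage (X : Type) (E : set (X * X)) :=
  [/\ (forall x, E (x, x)), (forall x y, E (x, y) -> E (y, x)) &
      (forall x y z, E (x, y) -> E (y, z) -> E (x, z))].

Definition nonarch_uniform (X : uniformType) :=
  forall E : set (X * X), entourage E -> exists F : set (X * X), [/\ entourage F, equiv_entourage F & F `<=` E].

(** Cardinal invariants, all taken to be infinite.  For a set K (on any
    type), "inv <= max(omega, |K|)" is expressed by a witness S with
    |S| <= |K| or S countable. *)
Definition card_le_inf (T Z : Type) (S : set T) (K : set Z) :=
  (S #<= K)%card \/ countable S.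

Definition character_le (G : topGroup) (Z : Type) (K : set Z) :=
  exists B : set (set G), card_le_inf B K /\
    (forall V, B V -> nbhs (tg_one G) V) /\
    (forall U, nbhs (tg_one G) U -> exists2 V, B V & V `<=` U).

Definition weight_le (T : topologicalType) (Z : Type) (K : set Z) :=
  exists B : set (set T), card_le_inf B K /\
    (forall V, B V -> open V) /\
    (forall (A : set T) x, open A -> A x -> exists V, [/\ B V, V x & V `<=` A]).

Definition uweight_le (X : uniformType) (Z : Type) (K : set Z) :=
  exists B : set (set (X * X)), card_le_inf B K /\
    (forall E, B E -> entourage E) /\
    (forall E : set (X * X), entourage E -> exists2 F, B F & F `<=` E).

Definition ulind_le (X : uniformType) (Z : Type) (K : set Z) :=
  forall E : set (X * X), entourage E -> exists A : set X,
    card_le_inf A K /\ forall y, exists2 x, A x & E (x, y).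

Definition ultrametric (X : Type) (R : realType) (d : X -> X -> R) :=
  [/\ (forall x y, 0 <= d x y), (forall x y, d x y = 0 <-> x = y),
      (forall x y, d x y = d y x) &
      (forall x y z, d x z <= Num.max (d x y) (d y z))].

Definition metric_induces_uniformity (X : uniformType) (R : realType)
    (d : X -> X -> R) :=
  forall E : set (X * X),
    entourage E <-> exists2 r : R, 0 < r & forall x y, d x y < r -> E (x, y).

(* Main.v *)
From HB Require Import structures.
Require Import Defs.
From mathcomp Require Import all_boot all_order all_algebra.
From mathcomp Require Import all_classical all_reals topology.
Set Implicit Arguments. Unset Strict Implicit. Unset Printing Implicit Defensive.
Import Order.TTheory GRing.Theory Num.Theory.
Local Open Scope classical_set_scope.

(** The free group is never constructed: everything is read off its universal
    property.  For an entourage E let N_E be the normal subgroup of G generated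
    by the elements i(x)^-1 i(y) with E(x,y).  Balanced NA groups have a base of
    open normal subgroups, so every neighbourhood of the identity contains some
    N_E.  The subgroup generated by i(X), with the N_E as a base at the identity,
    belongs to the class; the universal property turns it into a retract of G,
    hence it is all of G and every N_E is open.  Conversely an equivalence
    entourage E is recovered from G by extending x |-> E(x,.) to the discrete
    Boolean group of maps X -> bool.  Thus the N_E form a base at the identity
    whose traces on X form a base of the uniformity, which gives the character;
    the cosets of N_E are represented by words over an E-dense subset of X, which
    gives the weight; and g |-> inf {t > 0 | t >= 1 or g in N_{d < t}} is an
    ultra-norm. *)

(** * Cardinal arithmetic *)

(** Injections are handled as relations: this avoids subtypes and default values, and suits graphs
    produced by Zorn's lemma. *)
Lemma card_le_relP (T U : Type) (A : set T) (B : set U) :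
  (A #<= B)%card <-> exists r : T -> U -> Prop,
    (forall a, A a -> exists2 b, B b & r a b) /\
    (forall a a' b, A a -> A a' -> r a b -> r a' b -> a = a').
Proof.
split.
  move=> /card_leP[f].
  exists (fun a b => exists (a' : A) (b' : B), [/\ set_val a' = a, set_val b' = b & f a' = b']).
  split.
    move=> a Aa; exists (set_val (f (exist _ a (mem_set Aa)))).
      by apply: set_mem; exact: (svalP (f _)).
    by exists (exist _ a (mem_set Aa)), (f (exist _ a (mem_set Aa))).
  move=> a a' b _ _ [a1 [b1 [<- e1 f1]]] [a2 [b2 [<- e2 f2]]].
  have eb : b1 = b2 by apply: val_inj; exact: etrans e1 (esym e2).
  by congr set_val; apply: (@inj _ _ _ f); rewrite ?in_setT//; exact: etrans f1 (etrans eb (esym f2)).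
move=> [r [tot inj]].
have [[a0 Aa0]|nA] := pselect (A !=set0); last first.
  suff -> : A = set0 by exact: card_ge0.
  by apply/seteqP; split => // x Ax; apply: nA; exists x.
have [b0 Bb0 _] := tot _ Aa0.
have /choice[f fP] : forall a, exists b, A a -> B b /\ r a b.
  move=> a; have [Aa|nAa] := pselect (A a); last by exists b0.
  by have [b Bb rab] := tot _ Aa; exists b.
have finj : {in A &, injective f}.
  move=> x y /set_mem Ax /set_mem Ay fxy.
  have [_ rx] := fP _ Ax; have [_ ry] := fP _ Ay.
  by apply: (inj _ _ (f x)) => //; rewrite fxy.
apply: (card_le_trans (B := f @` A)); last first.
  by apply: subset_card_le => _ [a Aa <-]; have [] := fP _ Aa.
by have := inj_card_eq finj; rewrite card_eq_sym card_eq_le => /andP[].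
Qed.

(** Zorn on graphs of partial injections from [A] to [B]: a maximal graph with neither full domain
    nor full range could take one more pair. *)
Lemma card_le_total (T U : Type) (A : set T) (B : set U) :
  (A #<= B)%card \/ (B #<= A)%card.
Proof.
pose P (G : set (T * U)) := [/\ G `<=` A `*` B,
  (forall a b b', G (a, b) -> G (a, b') -> b = b') &
  (forall a a' b, G (a, b) -> G (a', b) -> a = a')].
have [F FP Ftot|G [[GAB Gf Gi] Gmax]] := @Zorn_bigcup _ P.
  have pick2 p q : (\bigcup_(G in F) G) p -> (\bigcup_(G in F) G) q ->
      exists G, [/\ F G, G p & G q].
    move=> [G1 FG1 G1p] [G2 FG2 G2q].
    by have [/(_ _ G1p)|/(_ _ G2q)] := Ftot _ _ FG1 FG2; [exists G2|exists G1].
  split.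
  - by move=> p [G FG Gp]; have [+ _ _] := FP _ FG; exact.
  - move=> a b b' /pick2 h /h[G [FG G1 G2]].
    by have [_ + _] := FP _ FG; apply; eassumption.
  - move=> a a' b /pick2 h /h[G [FG G1 G2]].
    by have [_ _ +] := FP _ FG; apply; eassumption.
have [domA|/existsNP[a /not_implyP[Aa na]]] :=
    pselect (forall a, A a -> exists b, G (a, b)).
  left; apply/card_le_relP; exists (fun a b => G (a, b)); split=> [a /domA[b Gab]|].
    by exists b => //; have [] := GAB _ Gab.
  by move=> a a' b _ _; exact: Gi.
have [ranB|/existsNP[b /not_implyP[Bb nb]]] :=
    pselect (forall b, B b -> exists a, G (a, b)).
  right; apply/card_le_relP; exists (fun b a => G (a, b)); split=> [b /ranB[a' Gab]|].
    by exists a' => //; have [] := GAB _ Gab.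
  by move=> b b' a' _ _; exact: Gf.
exfalso; apply: (Gmax (G `|` [set (a, b)])).
  split; first by move=> p; left.
  by move=> /(_ (a, b) (or_intror erefl)) Gab; apply: na; exists b.
split.
- by move=> p [/GAB|->].
- move=> x y y' [h|[-> ->]] [h'|[]]; [exact: Gf h h'| | |by move=> ->].
    by move=> ex _; subst x; case: na; exists y.
  by case: na; exists y'.
- move=> x x' y [h|[-> ->]] [h'|[]]; [exact: Gi h h'| | |by move=> ->].
    by move=> _ ey; subst y; case: nb; exists x.
  by case: nb; exists x'.
Qed.

Lemma card_leX (T T' U U' : Type) (A : set T) (B : set U) (A' : set T') (B' : set U') :
  (A #<= A')%card -> (B #<= B')%card -> (A `*` B #<= A' `*` B')%card.
Proof.
move=> /card_le_relP[r [rt ri]] /card_le_relP[s [st si]].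
apply/card_le_relP; exists (fun p q => r p.1 q.1 /\ s p.2 q.2); split.
  move=> [a b] [/= /rt[a' Aa' ra] /st[b' Bb' sb]].
  by exists (a', b').
move=> [a b] [a1 b1] [a' b'] [/= Aa Bb] [/= Aa1 Bb1] [ra sb] [ra1 sb1].
by congr pair; [exact: ri ra ra1|exact: si sb sb1].
Qed.

Lemma infinite_set_pair (T : Type) (A : set T) : infinite_set A ->
  exists a b, [/\ A a, A b & a <> b].
Proof.
move=> /infiniteP/card_le_relP[r [rt ri]].
have [a Aa ra] := rt 0 I; have [b Ab rb] := rt 1 I.
by exists a, b; split => // eab; have := ri 0 1 a I I ra; rewrite eab => /(_ rb).
Qed.

(** Two distinct elements [a], [b] of [A] serve as tags, so the union injects into the square of
    [A]. *)
Lemma card_leU_square (T U : Type) (A : set T) (B C : set U) : infinite_set A ->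
  (A `*` A #<= A)%card -> (B #<= A)%card -> (C #<= A)%card ->
  (B `|` C #<= A)%card.
Proof.
move=> /infinite_set_pair[a [b [Aa Ab nab]]] AA.
move=> /card_le_relP[r [rt ri]] /card_le_relP[s [st si]].
apply: card_le_trans AA; apply/card_le_relP.
exists (fun x p => (p.1 = a /\ B x /\ r x p.2) \/ (p.1 = b /\ C x /\ s x p.2)).
split.
  move=> x [Bx|Cx].
    by have [y Ay rxy] := rt _ Bx; exists (a, y) => //; left.
  by have [y Ay rxy] := st _ Cx; exists (b, y) => //; right.
move=> x y [u z] _ _ [[/= -> [Bx rx]]|[/= -> [Cx sx]]] [[eu [By ry]]|[eu [Cy sy]]].
- exact: ri rx ry.
- by case: nab.
- by case: nab.
- exact: si sx sy.
Qed.

(** Hessenberg's theorem. Zorn yields a maximal infinite [A] inside [K] carrying an injection of its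
    square into itself; maximality forces [K] to inject into [A]. *)
Lemma card_le_square (T : Type) (K : set T) : infinite_set K ->
  (K `*` K #<= K)%card.
Proof.
move=> Kinf.
(* [P G]: [G] is the graph of an injection of [D G * D G] into [D G], the domain
   [D G] being read off the diagonal of [G]. *)
pose D (G : set (T * T * T)) := [set x | exists z, G (x, x, z)].
pose P (G : set (T * T * T)) := [/\
  (forall x y z, G (x, y, z) -> [/\ D G x, D G y, D G z & K x]),
  (forall x y, D G x -> D G y -> exists z, G (x, y, z)),
  (forall p q z, G (p, z) -> G (q, z) -> p = q) &
  G !=set0 -> infinite_set (D G)].
have DS G G' : G `<=` G' -> D G `<=` D G' by move=> GG' x [z /GG' ?]; exists z.
have [F FP Ftot|G [[G1 G2 G3 G4] Gmax]] := @Zorn_bigcup _ P.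
  have pick2 p q : (\bigcup_(G in F) G) p -> (\bigcup_(G in F) G) q ->
      exists G, [/\ F G, G p & G q].
    move=> [G1 FG1 G1p] [G2 FG2 G2q].
    by have [/(_ _ G1p)|/(_ _ G2q)] := Ftot _ _ FG1 FG2; [exists G2|exists G1].
  have FS G : F G -> D G `<=` D (\bigcup_(G in F) G).
    by move=> FG; apply: DS => p Gp; exists G.
  split.
  - move=> x y z [G FG Gp]; have [+ _ _ _] := FP _ FG.
    by move=> /(_ _ _ _ Gp)[? ? ? ?]; split => //; apply: (FS G).
  - move=> x y [z xz] [t yt]; have [G [FG Gx Gy]] := pick2 _ _ xz yt.
    have [_ + _ _] := FP _ FG.
    by move=> /(_ x y)[|  |w Gw]; [exists z|exists t|exists w, G].
  - move=> p q z hp hq; have [G [FG Gp Gq]] := pick2 _ _ hp hq.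
    by have [_ _ + _] := FP _ FG; apply; eassumption.
  - move=> [p [G FG Gp]]; have [_ _ _ Ginf] := FP _ FG.
    by apply: sub_infinite_set (FS G FG) _; apply: Ginf; exists p.
(* The empty graph satisfies [P], as the empty chain requires. It is not maximal: a copy of the
   naturals in [K], with [pickle] as pairing, extends it. *)
have Gn0 : G !=set0.
  apply: contrapT => G0.
  have /infiniteP/card_le_relP[r [rt ri]] := Kinf.
  have /choice[g gP] : forall n, exists z, K z /\ r n z.
    by move=> n; have [z Kz rz] := rt n I; exists z.
  have ginj : injective g.
    move=> m n gmn; apply: (ri m n (g m)) => //; first by case: (gP m).
    by rewrite gmn; case: (gP n).
  pose H := range (fun q : nat * nat => (g q.1, g q.2, g (choice.pickle q))).
  have DH : D H = range g.
    apply/seteqP; split => [x [z [[m n] _ [/= <- _ _]]]|x [m _ <-]].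
      by exists m.
    by exists (g (choice.pickle (m, m))), (m, m).
  apply: (Gmax H).
    split; first by move=> p Gp; case: G0; exists p.
    move=> HG; apply: G0; exists (g 0, g 0, g (choice.pickle (0, 0))).
    by apply: HG; exists (0, 0).
  split.
  - move=> x y z [[m n] _ [<- <- <-]]; rewrite DH; split => //.
    by case: (gP m).
  - rewrite DH => _ _ [m _ <-] [n _ <-].
    by exists (g (choice.pickle (m, n))), (m, n).
  - move=> p q z [[m n] _ [<- <-]] [[m' n'] _ [<-]].
    by move=> /ginj/(pcan_inj choice.pickleK)[-> ->].
  - move=> _; rewrite DH; apply/infiniteP.
    have /card_esym : (range g #= [set: nat])%card.
      by apply: inj_card_eq => x y _ _ /ginj.
    by rewrite card_eq_le => /andP[].
set A := D G in G1 G2 G4; have Ainf := G4 Gn0.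
have AK : A `<=` K by move=> x [z /G1[]].
have AA : (A `*` A #<= A)%card.
  apply/card_le_relP; exists (fun p z => G (p, z)); split => [[x y] [Ax Ay]|p q z _ _].
    by have [z Gz] := G2 _ _ Ax Ay; exists z => //; have [] := G1 _ _ _ Gz.
  exact: G3.
suff KA : (K #<= A)%card.
  exact: card_le_trans (card_leX KA KA) (card_le_trans AA (subset_card_le AK)).
have [KDA|] := card_le_total (K `\` A) A.
  by have := card_leU_square Ainf AA (card_lexx A) KDA; rewrite setDUK.
(* Otherwise a disjoint copy [f @` A] of [A] fits in [K], and [G] extends to [A `|` f @` A]. *)
move=> /card_le_relP[r [rt ri]]; exfalso.
have [a0 [_ [Aa0 _ _]]] := infinite_set_pair Ainf.
have /choice[f fP] : forall x, exists y, A x -> (K `\` A) y /\ r x y.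
  move=> x; have [Ax|nAx] := pselect (A x); last by exists a0.
  by have [y Ky rxy] := rt _ Ax; exists y.
have finj x y : A x -> A y -> f x = f y -> x = y.
  move=> Ax Ay fxy; have [_ rx] := fP _ Ax; have [_ ry] := fP _ Ay.
  by apply: (ri _ _ (f x)) => //; rewrite fxy.
set C := A `|` f @` A.
have CA : (C #<= A)%card.
  by apply: card_leU_square => //; exact: card_image_le.
have := card_le_trans (card_leX CA CA) AA => /card_le_relP[s [st si]].
(* [N] sends the pairs of [C] not both in [A] into the image of [f], so its values never collide
   with those of [G], which lie in [A]. *)
pose N := [set q | [/\ C q.1.1, C q.1.2, ~ (A q.1.1 /\ A q.1.2) &
   exists z, [/\ A z, s q.1 z & q.2 = f z]]].
have fC z : A z -> C (f z) by move=> Az; right; exists z.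
have GNC p z : (G `|` N) (p, z) -> [/\ C p.1, C p.2 & C z].
  case: p => x y [/G1[? ? ? ?]|[/= ? ? _ [w [? _ ->]]]]; split => //; first [exact: fC|by left].
have GNt x y : C x -> C y -> exists z, (G `|` N) (x, y, z).
  move=> Cx Cy; have [[Ax Ay]|nA] := pselect (A x /\ A y).
    by have [z Gz] := G2 _ _ Ax Ay; exists z; left.
  have [z Az sz] := st (x, y) (conj Cx Cy).
  by exists (f z); right; split => //; exists z.
have DE : D (G `|` N) = C.
  apply/seteqP; split => [x [z /GNC[]]//|x Cx]; exact: GNt.
apply: (Gmax (G `|` N)).
  split; first by move=> p; left.
  move=> GNG; have [z GNz] := GNt _ _ (fC _ Aa0) (fC _ Aa0).
  have [+ _ _ _] := G1 _ _ _ (GNG _ GNz).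
  by have [[_ ?] _] := fP _ Aa0.
have GN_disj p q z : G (p, z) -> N (q, z) -> False.
  case: p => x y /G1[_ _ Az _] [_ _ _ [w [Aw _ /= ezw]]].
  by have [[_ +] _] := fP _ Aw; rewrite -ezw.
rewrite /P DE; split.
- move=> x y z /GNC[/= Cx Cy Cz]; split => //.
  by case: Cx => [/AK//|[w Aw <-]]; have [[]] := fP _ Aw.
- exact: GNt.
- move=> p q z [Gp|Np] [Gq|Nq]; first exact: G3 Gp Gq.
  + by case: (GN_disj _ _ _ Gp Nq).
  + by case: (GN_disj _ _ _ Gq Np).
  + move: Np Nq => [Cp1 Cp2 _ [w [Aw sw ew]]] [Cq1 Cq2 _ [v [Av sv ev]]].
    have ewv : w = v by apply: finj => //; rewrite -ew -ev.
    by apply: (si _ _ w) => //; rewrite ewv.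
- by move=> _; apply: sub_infinite_set Ainf; left.
Qed.

Lemma card_le_inf_trans (T U Z : Type) (A : set T) (B : set U) (K : set Z) :
  (A #<= B)%card -> card_le_inf B K -> card_le_inf A K.
Proof.
move=> AB [BK|cB]; [left; exact: card_le_trans BK|right; exact: card_le_trans cB].
Qed.

Lemma card_le_inf_image (T U Z : Type) (f : T -> U) (A : set T) (K : set Z) :
  card_le_inf A K -> card_le_inf (f @` A) K.
Proof. exact/card_le_inf_trans/card_image_le. Qed.

Lemma card_le_inf_sub (T Z : Type) (A B : set T) (K : set Z) :
  A `<=` B -> card_le_inf B K -> card_le_inf A K.
Proof. by move=> /subset_card_le; exact: card_le_inf_trans. Qed.

(** For uncountable [K], a point is coded by an index containing it and its code within that piece,
    giving an injection into the square of [K]. For countable [K] this is a countable union of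
    countable sets. *)
Lemma card_le_inf_bigcup (T U Z : Type) (A : set T) (F : T -> set U) (K : set Z) :
  card_le_inf A K -> (forall x, A x -> card_le_inf (F x) K) ->
  card_le_inf (\bigcup_(x in A) F x) K.
Proof.
move=> AK FK; have [cK|ncK] := pselect (countable K).
  right; apply: bigcup_countable => [|x /FK[]//].
    by case: AK => // AK; exact: card_le_trans cK.
  by move=> FxK; exact: card_le_trans cK.
have Kinf : infinite_set K by move=> /finite_set_countable.
have leK (V : Type) (B : set V) : card_le_inf B K -> (B #<= K)%card.
  by case=> // cB; apply: card_le_trans cB _; exact/infiniteP.
left; apply: card_le_trans (card_le_square Kinf).
have /card_le_relP[r [rt ri]] := leK _ _ AK.
have /choice[s sP] : forall x, exists s : U -> Z -> Prop, A x ->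
    (forall a, F x a -> exists2 b, K b & s a b) /\
    (forall a a' b, F x a -> F x a' -> s a b -> s a' b -> a = a').
  move=> x; have [/FK/leK/card_le_relP[s sP]|] := pselect (A x); last by exists (fun _ _ => True).
  by exists s.
apply/card_le_relP; exists (fun u k => exists x, [/\ A x, F x u, r x k.1 & s x u k.2]).
split.
  move=> u [x Ax Fxu]; have [k Kk rk] := rt _ Ax.
  have [+ _] := sP _ Ax => /(_ _ Fxu)[l Kl sl].
  by exists (k, l) => //; exists x.
move=> u v [k l] _ _ [x [Ax Fxu /= rx sx]] [y [Ay Fyv /= ry sy]].
have exy := ri _ _ _ Ax Ay rx ry; subst y.
have [_ si] := sP _ Ax; exact: si sx sy.
Qed.

Lemma card_le_inf_seq (T Z : Type) (A : set T) (K : set Z) :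
  card_le_inf A K -> card_le_inf [set w : seq T | all (mem A) w] K.
Proof.
move=> AK.
have step n : card_le_inf [set w : seq T | all (mem A) w /\ size w = n] K.
  elim: n => [|n IHn].
    right; apply: sub_countable (finite_set_countable (finite_set1 [::])).
    by apply: subset_card_le => w [_ /size0nil].
  apply: (card_le_inf_sub _ (card_le_inf_bigcup AK
    (fun x _ => card_le_inf_image (cons x) IHn))).
  by move=> [|x w] [//= /andP[/set_mem Ax Aw] [sw]]; exists x => //; exists w.
apply: (card_le_inf_sub _ (card_le_inf_bigcup (A := [set: nat]) _ (fun n _ => step n))).
  by move=> w h; exists (size w).
by right.
Qed.

(** * Group topologies given by a base of normal subgroups *)

(** Stated on a bare type, so that the same lemmas serve topological groups and groups whose
    topology is still to be built. *)
Record group_laws (T : Type) (mul : T -> T -> T) (inv : T -> T) (one : T) : Prop :=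
  GroupLaws {
    gl_mulA : forall x y z, mul x (mul y z) = mul (mul x y) z;
    gl_mul1g : forall x, mul one x = x;
    gl_mulVg : forall x, mul (inv x) x = one }.

Section GroupLawsTheory.
Variables (T : Type) (mul : T -> T -> T) (inv : T -> T) (one : T).
Hypothesis gl : group_laws mul inv one.
Local Notation "x * y" := (mul x y).
Local Notation "x ^-1" := (inv x).

Lemma gl_mulKg x y : x^-1 * (x * y) = y.
Proof. by rewrite (gl_mulA gl) (gl_mulVg gl) (gl_mul1g gl). Qed.

Lemma gl_mulgI x y z : x * y = x * z -> y = z.
Proof. by move=> /(congr1 (mul x^-1)); rewrite !gl_mulKg. Qed.

Lemma gl_mulgV x : x * x^-1 = one.
Proof.
apply: (@gl_mulgI x^-1); rewrite gl_mulKg; apply: (@gl_mulgI (x^-1)^-1).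
by rewrite gl_mulKg (gl_mulVg gl).
Qed.

Lemma gl_mulg1 x : x * one = x.
Proof. by rewrite -(gl_mulVg gl x) (gl_mulA gl) gl_mulgV (gl_mul1g gl). Qed.

Lemma gl_mulKVg x y : x * (x^-1 * y) = y.
Proof. by rewrite (gl_mulA gl) gl_mulgV (gl_mul1g gl). Qed.

Lemma gl_eqV x y : x * y = one -> y = x^-1.
Proof. by move=> xy; apply: (@gl_mulgI x); rewrite xy gl_mulgV. Qed.

Lemma gl_invgK x : (x^-1)^-1 = x.
Proof. by apply/esym/gl_eqV; rewrite (gl_mulVg gl). Qed.

Lemma gl_invMg x y : (x * y)^-1 = y^-1 * x^-1.
Proof. by apply/esym/gl_eqV; rewrite -(gl_mulA gl) gl_mulKVg gl_mulgV. Qed.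

Lemma gl_inv1g : one^-1 = one.
Proof. by apply/esym/gl_eqV; rewrite (gl_mul1g gl). Qed.

End GroupLawsTheory.

(** A group with a filter base of normal subgroups, destined to be a base at the identity; [nb_idx0]
    and [nb_directed] make it a filter base. *)
Record normal_base : Type := NormalBase {
  nb_car :> Type;
  nb_mul : nb_car -> nb_car -> nb_car;
  nb_inv : nb_car -> nb_car;
  nb_one : nb_car;
  nb_laws : group_laws nb_mul nb_inv nb_one;
  nb_idx : Type;
  nb_set : nb_idx -> set nb_car;
  nb_idx0 : nb_idx;
  nb_directed : forall k l, exists m, nb_set m `<=` nb_set k `&` nb_set l;
  nb_set1 : forall k, nb_set k nb_one;
  nb_setM : forall k x y, nb_set k x -> nb_set k y -> nb_set k (nb_mul x y);
  nb_setV : forall k x, nb_set k x -> nb_set k (nb_inv x);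
  nb_setJ : forall k x h, nb_set k h -> nb_set k (nb_mul (nb_inv x) (nb_mul h x)) }.

(** This alias keeps [b] visible in the type, so that the topology depends on the base and not only
    on the carrier. *)
Definition nb_space (b : normal_base) : Type := b.

Section NormalBaseTopology.
Variable b : normal_base.
Local Notation T := (nb_space b).
Let gl := nb_laws b.

HB.instance Definition _ := gen_eqMixin T.
HB.instance Definition _ := gen_choiceMixin T.

Definition nb_nbhs (x : T) : set (set T) :=
  [set A | exists k, forall h, @nb_set b k h -> A (nb_mul x h)].

HB.instance Definition _ := hasNbhs.Build T nb_nbhs.

Lemma nb_nbhs_filter (x : T) : ProperFilter (nbhs x).
Proof.
apply: Build_ProperFilter_ex.
  by move=> A [k kA]; exists (nb_mul x (nb_one b)); apply/kA/nb_set1.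
split.
- by exists (nb_idx0 b).
- move=> A B [k kA] [l lB]; have [m mkl] := nb_directed k l.
  by exists m => h /mkl[/kA ? /lB].
- by move=> A B AB [k kA]; exists k => h /kA/AB.
Qed.

Lemma nb_nbhs_singleton (x : T) (A : set T) : nbhs x A -> A x.
Proof. by move=> [k /(_ _ (nb_set1 k))]; rewrite (gl_mulg1 gl). Qed.

Lemma nb_nbhs_nbhs (x : T) (A : set T) : nbhs x A -> nbhs x (nbhs^~ A).
Proof.
move=> [k kA]; exists k => h kh; exists k => h' kh'.
by rewrite -(gl_mulA gl); apply/kA/nb_setM.
Qed.

HB.instance Definition _ := Nbhs_isNbhsTopological.Build T
  nb_nbhs_filter nb_nbhs_singleton nb_nbhs_nbhs.

Lemma nb_mul_continuous : continuous (fun p : T * T => nb_mul p.1 p.2 : T).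
Proof.
move=> [x y] A [k kA].
exists ([set z | exists2 h, @nb_set b k h & z = nb_mul x h],
        [set z | exists2 h, @nb_set b k h & z = nb_mul y h]).
  by split; exists k => h kh; exists h.
move=> [_ _] [[h kh /= ->] [h' kh' /= ->]] /=.
(* Moving [h] to the right of [y] conjugates it by [y], and normality keeps it in [nb_set k]. *)
have -> : nb_mul (nb_mul x h) (nb_mul y h') =
    nb_mul (nb_mul x y) (nb_mul (nb_mul (nb_inv y) (nb_mul h y)) h').
  by rewrite -!(gl_mulA gl) (gl_mulKVg gl).
by apply/kA/nb_setM => //; exact: nb_setJ.
Qed.

Lemma nb_inv_continuous : continuous (fun x : T => nb_inv x : T).
Proof.
move=> x A [k kA]; exists k => h kh /=.
have -> : nb_inv (nb_mul x h) =
    nb_mul (nb_inv x) (nb_mul (nb_inv (nb_inv x)) (nb_mul (nb_inv h) (nb_inv x))).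
  by rewrite (gl_invMg gl) (gl_mulKVg gl).
by apply/kA/nb_setJ/nb_setV.
Qed.

Definition nb_topGroup : topGroup := @TopGroup T (@nb_mul b) (@nb_inv b)
  (nb_one b) (gl_mulA gl) (gl_mul1g gl) (gl_mulVg gl)
  nb_mul_continuous nb_inv_continuous.

Lemma nb_nbhs_one (A : set T) :
  nbhs (nb_one b : T) A <-> exists k, @nb_set b k `<=` A.
Proof. by split=> -[k kA]; exists k => h /kA; rewrite (gl_mul1g gl). Qed.

(** If the cosets of [p] and [q] meet for every index, then [p^-1 q] lies in every [nb_set k]. *)
Lemma nb_hausdorff : (forall x, (forall k, @nb_set b k x) -> x = nb_one b) ->
  hausdorff_space T.
Proof.
move=> sep p q pq; apply/esym; apply: (@gl_mulgI _ _ _ _ gl (nb_inv p)).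
rewrite (gl_mulVg gl); apply: sep => k.
have [||_ [[h kh ->] [h' kh']]] := pq
  [set z | exists2 h, @nb_set b k h & z = nb_mul p h]
  [set z | exists2 h, @nb_set b k h & z = nb_mul q h].
- by exists k => h kh; exists h.
- by exists k => h kh; exists h.
move=> e; suff -> : nb_mul (nb_inv p) q = nb_mul h (nb_inv h').
  by apply: nb_setM => //; exact: nb_setV.
apply: (@gl_mulgI _ _ _ _ gl p); rewrite (gl_mulKVg gl) (gl_mulA gl) e.
by rewrite -(gl_mulA gl) (gl_mulgV gl) (gl_mulg1 gl).
Qed.

Lemma nb_NA : tg_NA nb_topGroup.
Proof.
move=> U /nb_nbhs_one[k kU]; exists (@nb_set b k); split => //; last first.
  split; first exact: nb_set1.
  by split; [exact: nb_setM|exact: nb_setV].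
by rewrite openE => x kx; exists k => h kh; exact: nb_setM.
Qed.

Lemma nb_balanced : tg_balanced nb_topGroup.
Proof.
split=> U /nb_nbhs_one[k kU]; exists (@nb_set b k); try by apply/nb_nbhs_one; exists k.
  move=> x y /= /(nb_setJ x) kxy; apply: kU; move: kxy.
  by rewrite -(gl_mulA gl) (gl_mulVg gl) (gl_mulg1 gl).
move=> x y /= /(nb_setJ (nb_inv x)) kxy; apply: kU; move: kxy.
by rewrite -(gl_mulA gl) (gl_mulKg gl).
Qed.

Lemma nb_in_class (c : NAclass) :
  (forall x, (forall k, @nb_set b k x) -> x = nb_one b) ->
  match c with
  | NA_balanced => True
  | NA_abelian => forall x y, @nb_mul b x y = nb_mul y x
  | NA_boolean => forall x, @nb_mul b x x = nb_one b
  end -> in_class c nb_topGroup.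
Proof.
move=> sep cP; split; first exact: nb_hausdorff.
split; first exact: nb_NA.
by case: c cP => [_|//|cP x _]; [exact: nb_balanced|exact: cP].
Qed.

End NormalBaseTopology.

(** * Normal neighbourhoods of the identity, and topologies on subgroups *)

Section TopGroupTheory.
Variable G : topGroup.
Local Notation "x * y" := (tg_mul x y).
Local Notation "x ^-1" := (tg_inv x).
Local Notation e := (tg_one G).

Lemma tg_laws : group_laws (@tg_mul G) (@tg_inv G) e.
Proof. by split; [exact: tg_mulA|exact: tg_mul1g|exact: tg_mulVg]. Qed.

Lemma tg_nbhs_mul (x y : G) (A : set G) :
  nbhs (x * y) A -> nbhs y [set z | A (x * z)].
Proof.
move=> /(@tg_mul_cont G (x, y))[[B C] /= [Bx Cy] BCA].
by apply: filterS Cy => z Cz; apply: (BCA (x, z)); split => //=; exact: nbhs_singleton.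
Qed.

Lemma tg_nbhsP (x : G) (A : set G) :
  nbhs x A <-> nbhs e [set h | A (x * h)].
Proof.
split=> [xA|].
  by apply: tg_nbhs_mul; rewrite (gl_mulg1 tg_laws).
rewrite -{1}(tg_mulVg x) => /tg_nbhs_mul.
by apply: filterS => z /=; rewrite (gl_mulKVg tg_laws).
Qed.

Definition normal_subgroup (N : set G) :=
  is_subgroup N /\ forall x h, N h -> N (x^-1 * (h * x)).

Lemma normal_subgroupC (N : set G) x y : normal_subgroup N ->
  N (x * y) -> N (y * x).
Proof.
move=> [_ NJ] /(NJ x).
by rewrite -tg_mulA (gl_mulKg tg_laws).
Qed.

Lemma tg_boolean_abelian : tg_boolean G -> tg_abelian G.
Proof.
move=> Gbool; have sq x : x * x = e.
  have [->|/eqP/Gbool//] := eqVneq x e; exact: tg_mul1g.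
have invE (x : G) : x^-1 = x by apply/esym; exact: (gl_eqV tg_laws (sq x)).
by move=> x y; rewrite -[LHS]invE (gl_invMg tg_laws) !invE.
Qed.

Lemma in_class_balanced (c : NAclass) : in_class c G -> tg_balanced G.
Proof.
move=> [_ [_]]; have abel_bal : tg_abelian G -> tg_balanced G.
  move=> Gab; split=> U nU; exists U => // x y; by rewrite Gab.
by case: c => // /tg_boolean_abelian.
Qed.

(** The normal core of an open subgroup [H] works: balance gives one [V] with [x^-1 V x] inside [H]
    for all [x] at once, so the core contains [V]. *)
Lemma balanced_normal_nbhs : tg_NA G -> tg_balanced G ->
  forall U, nbhs e U -> exists N : set G, [/\ normal_subgroup N, nbhs e N & N `<=` U].
Proof.
move=> na [_ bal] U /na[H [openH [He [HM HV]] HU]].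
have [V nV VH] : exists2 V, nbhs e V & forall x y, V (x^-1 * y) -> H (y * x^-1).
  by apply: bal; exact: open_nbhs_nbhs.
exists [set h | forall x, H (x^-1 * (h * x))]; split.
- split; [split; [|split]|] => /=.
  + by move=> x; rewrite tg_mul1g tg_mulVg.
  + move=> h h' Hh Hh' x; have := HM _ _ (Hh x) (Hh' x).
    by rewrite -!tg_mulA (gl_mulKVg tg_laws).
  + move=> h Hh x; have := HV _ (Hh x).
    by rewrite !(gl_invMg tg_laws) (gl_invgK tg_laws) -tg_mulA.
  + move=> x h Hh y; have := Hh (x * y).
    by rewrite (gl_invMg tg_laws) -!tg_mulA.
(* Balance is applied to the pair [x^-1], [x^-1 v], whose left quotient is [v] and right quotient is
   [x^-1 v x]. *)
- apply: filterS nV => v Vv x; have := VH x^-1 (x^-1 * v).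
  by rewrite (gl_invgK tg_laws) (gl_mulKVg tg_laws) -tg_mulA; apply.
- by move=> h /(_ e) He'; apply: HU; move: He'; rewrite (gl_inv1g tg_laws) tg_mul1g (gl_mulg1 tg_laws).
Qed.

Lemma hausdorff_nbhs_one (x : G) : hausdorff_space G ->
  (forall U, nbhs e U -> U x) -> x = e.
Proof.
move=> hG xU; apply/esym/hG => A B /xU Ax /nbhs_singleton Bx.
by exists x.
Qed.

Section SubBase.
Variables (S : set G) (S_subgroup : is_subgroup S).
Variables (I : Type) (N : I -> set G) (k0 : I).
Hypothesis N_directed : forall k l, exists m, N m `<=` N k `&` N l.
Hypothesis N_normal : forall k, normal_subgroup (N k).

(** The topology comes from the traces of the [N k] and may differ from the one induced by [G].
    Transparent, since later proofs compute its projections. *)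
Definition sub_base : normal_base.
Proof.
unshelve refine (@NormalBase {x : G | S x}
  (fun x y => exist _ (sval x * sval y) (S_subgroup.2.1 _ _ (svalP x) (svalP y)))
  (fun x => exist _ ((sval x)^-1) (S_subgroup.2.2 _ (svalP x)))
  (exist _ e S_subgroup.1) _ I (fun k => [set x | N k (sval x)]) k0 _ _ _ _ _).
- split=> [[x Sx] [y Sy] [z Sz]|[x Sx]|[x Sx]]; apply: eq_exist => /=.
  + exact: tg_mulA.
  + exact: tg_mul1g.
  + exact: tg_mulVg.
- by move=> k l; have [m mkl] := N_directed k l; exists m => x /mkl.
- by move=> k; have [[]] := N_normal k.
- by move=> k x y; have [[_ [NM _]] _] := N_normal k; exact: NM.
- by move=> k x; have [[_ [_ NV]] _] := N_normal k; exact: NV.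
- by move=> k x h; have [_ NJ] := N_normal k; exact: NJ.
Defined.

(** The assumption on the [N k] makes this topology at least as fine as the induced one, hence
    Hausdorff; the algebraic identities are inherited. *)
Lemma sub_base_in_class (c : NAclass) : in_class c G ->
  (forall U, nbhs e U -> exists k, N k `<=` U) -> in_class c (nb_topGroup sub_base).
Proof.
move=> [hG [_ cG]] NU; apply: nb_in_class.
  move=> [x Sx] xN; apply: eq_exist; apply: hausdorff_nbhs_one => // U /NU[k]; apply.
  exact: xN.
by case: c cG => //= [ab|bo] [x Sx]; [case=> y Sy|]; apply: eq_exist => //=;
  have [->|/eqP/bo//] := eqVneq x e; exact: tg_mul1g.
Qed.

End SubBase.
End TopGroupTheory.

(** * The topology of the free group *)

Section DiscreteBooleanGroup.
Variable X : Type.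

(** The power of the two-element group over [X], made discrete by taking the trivial subgroup as the
    only basic set. *)
Definition bool_base : normal_base.
Proof.
unshelve refine (@NormalBase (X -> bool) (fun f g x => f x (+) g x) id
  (fun=> false) _ unit (fun=> [set (fun=> false)]) tt _ _ _ _ _).
- split=> [f g h|f|f]; apply/funext => x.
  + exact: addbA.
  + exact: addFb.
  + exact: addbb.
- by move=> _ _; exists tt => f ->.
- by [].
- by move=> _ f g -> ->.
- by move=> _ f ->.
- by move=> _ f g ->; apply/funext => x; rewrite addFb addbb.
Defined.

Lemma bool_base_in_class (c : NAclass) : in_class c (nb_topGroup bool_base).
Proof.
apply: nb_in_class => [f /(_ tt)//|].
case: c => // [f g|f]; apply/funext => x /=; [exact: addbC|exact: addbb].
Qed.

End DiscreteBooleanGroup.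

Section FreeGroup.
Variables (X : uniformType) (c : NAclass) (G : topGroup) (i : X -> G).
Hypothesis Gfree : is_free_group c i.
Local Notation "x * y" := (tg_mul x y).
Local Notation "x ^-1" := (tg_inv x).
Local Notation e := (tg_one G).

Let Gc : in_class c G. Proof. by case: Gfree. Qed.
Let iuc : unif_cont_2s i. Proof. by case: Gfree => _ []. Qed.
Let gl := tg_laws G.

Definition gen_subgroup : set G :=
  [set g | forall S, is_subgroup S -> (forall x, S (i x)) -> S g].

Lemma gen_subgroupP : is_subgroup gen_subgroup.
Proof.
split; first by move=> S [].
split=> [g h Sg Sh S HS Si|g Sg S HS Si]; have [_ [SM SV]] := HS.
  exact: SM (Sg S HS Si) (Sh S HS Si).
exact: SV (Sg S HS Si).
Qed.

Lemma gen_subgroup_i x : gen_subgroup (i x).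
Proof. by move=> S _. Qed.

Definition ent_normal (E : set (X * X)) : set G :=
  [set g | forall N, normal_subgroup N ->
     (forall x y, E (x, y) -> N ((i x)^-1 * i y)) -> N g].

Lemma ent_normal_normal E : normal_subgroup (ent_normal E).
Proof.
split; [split; [|split]|].
- by move=> N [[]].
- move=> g h Ng Nh N HN NE; have [[_ [NM _]] _] := HN.
  exact: NM (Ng N HN NE) (Nh N HN NE).
- move=> g Ng N HN NE; have [[_ [_ NV]] _] := HN.
  exact: NV (Ng N HN NE).
- by move=> x h Nh N HN NE; have [_ NJ] := HN; exact: NJ (Nh N HN NE).
Qed.

Lemma ent_normal_gen E x y : E (x, y) -> ent_normal E ((i x)^-1 * i y).
Proof. by move=> Exy N _; apply. Qed.

Lemma ent_normalS E F : E `<=` F -> ent_normal E `<=` ent_normal F.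
Proof. by move=> EF g gE N HN NF; apply: gE => // x y /EF; exact: NF. Qed.

Lemma ent_normal_base (U : set G) : nbhs e U ->
  exists2 E, entourage E & ent_normal E `<=` U.
Proof.
have [_ [na _]] := Gc.
move=> /(balanced_normal_nbhs na (in_class_balanced Gc))[N [HN nN NU]].
have [E entE EN] := iuc nN.
by exists E => // g gE; apply/NU/(gE N HN) => x y /EN[].
Qed.

Let ent_idx := {E : set (X * X) | entourage E}.

Definition gen_base : normal_base.
Proof.
refine (@sub_base G gen_subgroup gen_subgroupP ent_idx (ent_normal \o sval)
  (exist _ setT entourageT) _ (fun E => ent_normal_normal (sval E))).
move=> [E entE] [F entF]; exists (exist _ (E `&` F) (filterI entE entF)) => g gEF /=.
by split; apply: ent_normalS gEF => p [].
Defined.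

(** The universal property extends the corestriction of [i] to some [F]. Then [sval \o F] is a
    continuous endomorphism extending [i], so uniqueness makes it the identity. *)
Lemma free_retraction : exists F : G -> nb_topGroup gen_base,
  cont_hom F /\ forall g, sval (F g) = g.
Proof.
have gen_class : in_class c (nb_topGroup gen_base).
  apply: sub_base_in_class => // U /ent_normal_base[E entE EU].
  by exists (exist _ E entE).
pose j (x : X) : nb_topGroup gen_base := exist _ (i x) (gen_subgroup_i x).
have juc : unif_cont_2s j.
  move=> V /nb_nbhs_one[[E entE] EV]; exists E => // x y /ent_normal_gen Exy.
  split; apply: EV => //=.
  by apply: (normal_subgroupC (ent_normal_normal E)).
have [_ [_ univ]] := Gfree.
have [F [[Fcont Fmul] jF _]] := univ _ gen_class j juc.
exists F; split => //.
have [F0 [_ _ F0uniq]] := univ _ Gc i iuc.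
suff Fid : (fun g => sval (F g)) = id :> (G -> G) by move=> g; exact: (congr1 (@^~ g) Fid).
have svalcont : continuous (sval : nb_topGroup gen_base -> G).
  move=> p A /tg_nbhsP/ent_normal_base[E entE EA].
  by exists (exist _ E entE) => h /EA.
rewrite (F0uniq id) //; last by split => // x; exact: cvg_id.
apply: F0uniq.
  split; last by move=> x y; rewrite Fmul.
  by move=> x; exact: (continuous_comp (Fcont x) (svalcont (F x))).
by apply/funext => x; rewrite /= -[F (i x)]/((F \o i) x) -jF.
Qed.

Lemma gen_subgroup_full (g : G) : gen_subgroup g.
Proof. by have [F [_ Fid]] := free_retraction; rewrite -(Fid g); exact: svalP. Qed.

(** Under the continuous [F] of [free_retraction], [ent_normal E] is the preimage of a basic
    neighbourhood of the identity. *)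
Lemma ent_normal_nbhs E : entourage E -> nbhs e (ent_normal E).
Proof.
move=> entE; have [F [[Fcont _] Fid]] := free_retraction.
have Fe : F e = nb_one gen_base.
  by move: (Fid e); case: (F e) => z Sz /= ze; exact: eq_exist.
have /Fcont FeE : nbhs (F e) [set x | ent_normal E (sval x)].
  by rewrite Fe; apply/nb_nbhs_one; exists (exist _ E entE).
rewrite (_ : ent_normal E = F @^-1` [set x | ent_normal E (sval x)])//.
by apply/funext => g; rewrite /preimage /= Fid.
Qed.

(** With [F] an equivalence entourage inside [E], sending a point to its class is uniformly
    continuous into a discrete group; [V] is the kernel of the extension [f]. *)
Lemma free_ent_pullback E : nonarch_uniform X -> entourage E ->
  exists2 V, nbhs e V & forall x y, V ((i x)^-1 * i y) -> E (x, y).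
Proof.
move=> naX /naX[F [entF [Fr Fs Ft] FE]].
pose j (x : X) : nb_topGroup (bool_base X) := fun y => `[< F (x, y) >].
have juc : unif_cont_2s j.
  move=> V /nb_nbhs_one[[] V0]; exists F => // x y Fxy.
  have -> : j x = j y.
    apply/funext => z; apply/asbool_equiv_eq; split; last exact: Ft.
    by apply: Ft; exact: Fs.
  by split; apply: V0; apply/funext => z /=; exact: addbb.
have [_ [_ univ]] := Gfree.
have [f [[fcont fmul] jf _]] := univ _ (bool_base_in_class X c) j juc.
have fe : f e = nb_one (bool_base X).
  apply: (gl_mulgI (nb_laws (bool_base X)) (x := f e)).
  by rewrite -[LHS]fmul tg_mul1g (gl_mulg1 (nb_laws _)).
exists (f @^-1` [set (fun=> false)]).
  by apply: fcont; rewrite fe; apply/nb_nbhs_one; exists tt.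
move=> x y /= fxy; apply: FE.
have : f ((i x) * ((i x)^-1 * i y)) = f (i x).
  by rewrite fmul fxy; apply: (gl_mulg1 (nb_laws (bool_base X))).
rewrite (gl_mulKVg gl) -[f (i y)]/((f \o i) y) -[f (i x)]/((f \o i) x) -jf.
(* The classes of [x] and [y] agree; evaluating at [y], which lies in its own class, gives
   [F (x, y)]. *)
move=> /(congr1 (@^~ y)) jxy; apply/asboolP; suff : j x y by [].
by rewrite -jxy; apply/asboolP.
Qed.

End FreeGroup.

(** * Character, weight and ultra-norm *)

(** One point chosen in the preimage of each basic open set gives an [E]-dense set. It is used with
    [f] the map [i] and with [f] the identity. *)
Lemma weight_le_ulind (X : uniformType) (T : topologicalType) (f : X -> T)
    (Z : Type) (K : set Z) :
  (forall E, entourage E -> forall y, exists2 W, nbhs (f y) W &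
     forall x, W (f x) -> E (x, y)) ->
  weight_le T K -> ulind_le X K.
Proof.
move=> fE [B [BK [_ Bb]]] E entE.
(* The point [x0] is the default for basic sets with empty preimage, so empty [X] is treated
   apart. *)
have [[x0 _]|nX] := pselect (exists x : X, True); last first.
  by exists set0; split => [|y]; [right; exact: countable0|case: nX; exists y].
have /choice[a aP] : forall V : set T, exists x, (exists x, V (f x)) -> V (f x).
  move=> V; have [[x Vx]|nV] := pselect (exists x, V (f x)); first by exists x.
  by exists x0.
exists (a @` B); split; first exact: card_le_inf_image.
move=> y; have [W] := fE _ entE y; rewrite nbhsE => -[W' [oW' W'y] W'W] WE.
have [V [BV Vy VW']] := Bb _ _ oW' W'y.
by exists (a V); [exists V|apply/WE/W'W/VW'; apply: aP; exists y].
Qed.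

Lemma weight_le_embedding (X T : topologicalType) (f : X -> T)
    (Z : Type) (K : set Z) :
  continuous f ->
  (forall x A, nbhs x A -> exists2 W, nbhs (f x) W & f @^-1` W `<=` A) ->
  weight_le T K -> weight_le X K.
Proof.
move=> fc fA [B [BK [Bo Bb]]].
exists ((fun V => f @^-1` V) @` B); split; first exact: card_le_inf_image.
split=> [_ [V /Bo oV <-]|A x oA Ax]; first by move/continuousP: fc; exact.
have [|W] := fA x A; first exact: open_nbhs_nbhs.
rewrite nbhsE => -[W' [oW' W'x] W'W] WA.
have [V [BV Vx VW']] := Bb _ _ oW' W'x.
exists (f @^-1` V); split => //; first by exists V.
by move=> y /VW'/W'W; exact: WA.
Qed.

Section FreeGroupInvariants.
Variables (X : uniformType) (c : NAclass) (G : topGroup) (i : X -> G).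
Hypothesis Gfree : is_free_group c i.
Hypothesis naX : nonarch_uniform X.
Local Notation "x * y" := (tg_mul x y).
Local Notation "x ^-1" := (tg_inv x).
Local Notation e := (tg_one G).

Let iuc : unif_cont_2s i. Proof. by case: Gfree => _ []. Qed.
Let gl := tg_laws G.

Lemma free_character (Z : Type) (K : set Z) : character_le G K <-> uweight_le X K.
Proof.
split=> -[B [BK [Bn Bb]]].
  exists ((fun V => [set p | V ((i p.1)^-1 * i p.2)]) @` B).
  split; first exact: card_le_inf_image.
  split=> [_ [V /Bn/iuc[E entE EV] <-]|E entE].
    by apply: filterS entE => -[x y] /EV[].
  have [V /Bb[W BW WV] VE] := free_ent_pullback Gfree naX entE.
  exists [set p | W ((i p.1)^-1 * i p.2)]; first by exists W.
  by move=> [x y] /= /WV; exact: VE.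
exists (ent_normal i @` B); split; first exact: card_le_inf_image.
split=> [_ [E /Bn entE <-]|U /(ent_normal_base Gfree)[E /Bb[F BF FE] EU]].
  exact: (ent_normal_nbhs Gfree entE).
exists (ent_normal i F); first by exists F.
by move=> g /(ent_normalS FE); exact: EU.
Qed.

(** The boolean is the sign of the exponent: [true] for [i x], [false] for its inverse. *)
Definition word_eval (w : seq (bool * X)) : G :=
  foldr (fun p g => (if p.1 then i p.2 else (i p.2)^-1) * g) e w.

Definition words (A : set X) : set (seq (bool * X)) :=
  [set w | all (mem [set p : bool * X | A p.2]) w].

Lemma word_eval_cat u v : word_eval (u ++ v) = word_eval u * word_eval v.
Proof. by elim: u => [|p u IHu] /=; rewrite ?tg_mul1g// IHu tg_mulA. Qed.

Lemma word_eval_inv A w : words A w ->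
  exists2 v, words A v & word_eval v = (word_eval w)^-1.
Proof.
elim: w => [_|[b x] w IHw /andP[Ax /IHw[v Av vw]]].
  by exists [::] => //=; rewrite (gl_inv1g gl).
exists (v ++ [:: (~~ b, x)]).
  by rewrite /words /= all_cat /= (Av : all _ _) andbT; move: Ax; rewrite !inE.
rewrite word_eval_cat vw /= (gl_mulg1 gl) (gl_invMg gl).
by case: b {Ax} => //=; rewrite (gl_invgK gl).
Qed.

(** The elements congruent to a word over [A] modulo [ent_normal i E] form a subgroup containing the
    image of [i], which generates [G]. *)
Lemma word_eval_dense (A : set X) E : (forall y, exists2 x, A x & E (x, y)) ->
  forall g, exists2 w, words A w & ent_normal i E ((word_eval w)^-1 * g).
Proof.
move=> AE g; have [[N1 [NM NV]] NJ] := ent_normal_normal i E.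
pose S := [set g | exists2 w, words A w & ent_normal i E ((word_eval w)^-1 * g)].
apply: (gen_subgroup_full Gfree g (S := S)).
  split; first by exists [::] => //=; rewrite tg_mulVg.
  split.
    move=> x y [u Au Nu] [v Av Nv]; exists (u ++ v).
      by rewrite /words /= all_cat (Au : all _ _).
    rewrite word_eval_cat.
    (* [(uv)^-1 xy] is the conjugate of [u^-1 x] by [v], times [v^-1 y]. *)
    have := NM _ _ (NJ (word_eval v) _ Nu) Nv.
    by rewrite (gl_invMg gl) -!tg_mulA (gl_mulKVg gl).
  move=> x [u /word_eval_inv[v Av vu] Nu]; exists v => //.
  rewrite vu (gl_invgK gl); apply: (normal_subgroupC (ent_normal_normal i E)).
  by have := NV _ Nu; rewrite (gl_invMg gl) (gl_invgK gl).
move=> y; have [x Ax Exy] := AE y; exists [:: (true, x)].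
  by rewrite /words /= andbT; apply/mem_set.
by rewrite /= (gl_mulg1 gl); exact: ent_normal_gen.
Qed.

Lemma card_le_inf_words (A : set X) (Z : Type) (K : set Z) :
  card_le_inf A K -> card_le_inf (words A) K.
Proof.
move=> AK; apply: card_le_inf_seq.
apply: (card_le_inf_sub _ (card_le_inf_bigcup (A := [set: bool]) _
  (fun b _ => card_le_inf_image (pair b) AK))).
  by move=> [b x] /= Ax; exists b => //; exists x.
by right.
Qed.

Lemma weight_le_character (Z : Type) (K : set Z) : weight_le G K -> character_le G K.
Proof.
move=> [B [BK [Bo Bb]]]; exists [set V | B V /\ V e].
split; first by apply: card_le_inf_sub BK => V [].
split=> [V [/Bo oV Ve]|U]; first exact: open_nbhs_nbhs.
rewrite nbhsE => -[W [oW We] WU]; have [V [BV Ve VW]] := Bb _ _ oW We.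
by exists V => // x /VW/WU.
Qed.

(** Both orders are recorded: [E (x, y)] serves the density number, [E (y, x)] the embedding of [X]
    into [G]. *)
Lemma free_ent_nbhs E : entourage E -> forall y,
  exists2 W, nbhs (i y) W & forall x, W (i x) -> E (x, y) /\ E (y, x).
Proof.
move=> entE y; have [V nV VE] := free_ent_pullback Gfree naX
  (filterI entE (entourage_inv entE)).
exists [set g | V ((i y)^-1 * g)].
  apply/tg_nbhsP; apply: filterS nV => h Vh.
  by rewrite /= (gl_mulKg gl).
by move=> x /VE[].
Qed.

Lemma free_weight (Z : Type) (K : set Z) :
  weight_le G K <-> uweight_le X K /\ ulind_le X K.
Proof.
split=> [GK|[[B [BK [Bent Bb]]] lX]].
  split; first exact/free_character/weight_le_character.
  apply: (weight_le_ulind (f := i)) GK => E entE y.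
  by have [W nW WE] := free_ent_nbhs entE y; exists W => // x /WE[].
have /choice[A AP] : forall E : set (X * X), exists A : set X, entourage E ->
    card_le_inf A K /\ forall y, exists2 x, A x & E (x, y).
  move=> E; have [/lX[A AP]|] := pselect (entourage E); first by exists A.
  by exists set0.
pose coset E w := [set g | ent_normal i E ((word_eval w)^-1 * g)].
exists (\bigcup_(E in B) (coset E @` words (A E))); split.
  apply: card_le_inf_bigcup => // E BE; apply/card_le_inf_image/card_le_inf_words.
  by have [] := AP _ (Bent _ BE).
split.
  move=> _ [E /Bent entE [w _ <-]]; rewrite openE => g Ng.
  have [[_ [NM _]] _] := ent_normal_normal i E.
  apply/tg_nbhsP; apply: filterS (ent_normal_nbhs Gfree entE) => h Nh.
  by rewrite /coset /= tg_mulA; exact: NM.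
move=> U g oU Ug.
have /tg_nbhsP/(ent_normal_base Gfree)[E /Bb[F BF FE] EU] : nbhs g U.
  exact: open_nbhs_nbhs.
have [_ AF] := AP _ (Bent _ BF); have [w Aw wg] := word_eval_dense AF g.
exists (coset F w); split => //; first by exists F => //; exists w.
move=> z wz; have [[_ [NM NV]] _] := ent_normal_normal i F.
(* Since [g] and [z] lie in one coset of [ent_normal i F], the quotient [g^-1 z] lies in it, hence
   in [ent_normal i E]. *)
rewrite -(gl_mulKVg gl g z); apply/EU; apply: (ent_normalS FE).
have := NM _ _ (NV _ wg) wz.
by rewrite (gl_invMg gl) (gl_invgK gl) -tg_mulA (gl_mulKVg gl).
Qed.

(** * The ultra-norm in the metric case *)

Section Ultrametric.
Variables (R : realType) (d : X -> X -> R).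
Hypothesis d_unif : metric_induces_uniformity d.
Local Open Scope ring_scope.

Definition ent_ball (t : R) : set (X * X) := [set p | d p.1 p.2 < t].

Lemma ent_ball_entourage t : 0 < t -> entourage (ent_ball t).
Proof. by move=> t0; apply/d_unif; exists t. Qed.

(** Balls of radius [1/(n+1)] form a countable base, and a countable base is within every bound
    because the invariants are infinite. *)
Lemma uweight_le_metric (Z : Type) (K : set Z) : uweight_le X K.
Proof.
exists (range (fun n => ent_ball (n.+1%:R^-1)%R)); split.
  by right; apply: card_le_trans (card_image_le _ _) _.
split=> [_ [n _ <-]|E /d_unif[r r0 rE]].
  by apply: ent_ball_entourage; rewrite invr_gt0.
exists (ent_ball (Num.bound r^-1).+1%:R^-1)%R; first by exists (Num.bound r^-1).
move=> [x y] /= dxy; apply: rE; apply: lt_trans dxy _.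
rewrite invf_plt ?posrE//; apply: lt_trans (archi_boundP _) _.
  by rewrite invr_ge0 ltW.
by rewrite ltr_nat.
Qed.

(** The alternative [1 <= t] keeps the set nonempty and caps the norm at 1. *)
Definition norm_radii (g : G) : set R :=
  [set t | 0 < t /\ (1 <= t \/ ent_normal i (ent_ball t) g)].

Definition free_norm (g : G) : R := inf (norm_radii g).

Lemma norm_radii_neq0 g : norm_radii g !=set0.
Proof. by exists 1; split => //; left. Qed.

Lemma norm_radii_up g s t : norm_radii g s -> s <= t -> norm_radii g t.
Proof.
move=> [s0 sg] st; split; first exact: lt_le_trans st.
case: sg => [s1|sg]; [by left; exact: le_trans st|right].
by apply: ent_normalS sg => p /= ps; exact: lt_le_trans st.
Qed.

Lemma free_norm_le g t : norm_radii g t -> free_norm g <= t.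
Proof. by apply: ge_inf; exists 0 => s [/ltW]. Qed.

(** The radii are upward closed, so every [t] strictly above the infimum is itself a radius. *)
Lemma free_norm_lt g t : free_norm g < t -> norm_radii g t.
Proof.
move=> /(inf_lt (norm_radii_neq0 g))[s gs st].
exact: norm_radii_up (ltW st).
Qed.

Lemma free_norm_ge0 g : 0 <= free_norm g.
Proof. by apply: lb_le_inf => [|t [/ltW]]; first exact: norm_radii_neq0. Qed.

Lemma free_norm_nbhs (U : set G) : nbhs e U ->
  exists2 r, 0 < r & forall g, free_norm g < r -> U g.
Proof.
move=> /(ent_normal_base Gfree)[E /d_unif[r r0 rE] EU].
(* The bound 1/2 excludes the alternative [1 <= t]. *)
exists (Num.min r 2^-1) => [|g /free_norm_lt[_ [|gr]]].
- by rewrite lt_min r0 invr_gt0 ltr0n.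
- by rewrite le_min => /andP[_]; rewrite leNgt invf_lt1// ltr1n.
- apply/EU; apply: ent_normalS gr => -[x y] /= dxy; apply: rE.
  by apply: lt_le_trans dxy _; rewrite ge_min lexx.
Qed.

Lemma free_norm_ultra : ultra_norm free_norm.
Proof.
have norm1 : free_norm e = 0.
  apply/eqP; rewrite eq_le free_norm_ge0 andbT; apply/ler_addgt0Pl => t t0.
  rewrite addr0; apply: free_norm_le; split => //; right.
  by have [[]] := ent_normal_normal i (ent_ball t).
split.
- exact: free_norm_ge0.
- exact: norm1.
- move=> g; congr inf; apply/seteqP.
  have sub h : norm_radii h `<=` norm_radii (tg_inv h).
    move=> t [t0 [t1|th]]; split => //; [by left|right].
    by have [[_ [_ NV]] _] := ent_normal_normal i (ent_ball t); exact: NV.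
  by split => // t /sub; rewrite (gl_invgK gl).
(* Otherwise the midpoint [t] between the maximum and the norm of the product is a radius of both
   factors, hence of the product, which is absurd. *)
- move=> g h; rewrite leNgt; apply/negP => /midf_lt[].
  set t := (_ / _); rewrite gt_max => /andP[/free_norm_lt[t0 gt] /free_norm_lt[_ ht]].
  rewrite ltNge => /negP; apply; apply: free_norm_le; split => //.
  case: gt => [|gt]; first by left.
  case: ht => [|ht]; first by left.
  right; have [[_ [NM _]] _] := ent_normal_normal i (ent_ball t); exact: NM.
- move=> g g0; have [[hG _] _] := Gfree; apply: hausdorff_nbhs_one => //.
  by move=> U /free_norm_nbhs[r r0]; apply; rewrite g0.
Qed.

Lemma free_norm_topology : norm_induces_topology free_norm.
Proof.
move=> g A; split=> [/tg_nbhsP/free_norm_nbhs[r r0 rA]|[r r0 rA]].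
  by exists r => // h /rA /=; rewrite (gl_mulKVg gl).
apply/tg_nbhsP.
(* Membership in [ent_normal] of a ball bounds the norm only weakly by the radius; halving makes the
   inequality strict. *)
have r20 : 0 < r / 2 by rewrite divr_gt0.
apply: filterS (ent_normal_nbhs Gfree (ent_ball_entourage r20)) => h hr /=.
apply: rA; rewrite (gl_mulKg gl); apply: (@le_lt_trans _ _ (r / 2)).
  by apply: free_norm_le; split => //; right.
by rewrite ltr_pdivrMr// ltr_pMr// ltr1n.
Qed.

End Ultrametric.

Lemma free_embedding_continuous : continuous i.
Proof.
move=> x A /tg_nbhsP/iuc[E entE EA].
apply: filterS (nbhs_entourage x entE) => y /xsectionP/EA[/=].
by rewrite (gl_mulKVg gl).
Qed.

(** As [i] is an embedding, the weight of [G] bounds that of [X]. Conversely the uniform weight is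
    countable, and the weight of [X] bounds [l(U)]. *)
Lemma free_weight_metric (R : realType) (d : X -> X -> R) (Z : Type) (K : set Z) :
  metric_induces_uniformity d -> weight_le G K <-> weight_le X K.
Proof.
move=> d_unif; split.
  apply: weight_le_embedding free_embedding_continuous _ => x A.
  move=> /nbhsP[E entE EA]; have [W nW WE] := free_ent_nbhs entE x.
  by exists W => // y /WE[_ xy]; apply/EA/xsectionP.
move=> XK; apply/free_weight; split; first exact: uweight_le_metric d_unif _ _.
apply: (weight_le_ulind (f := id)) XK => E entE y.
exists (xsection E^-1%relation y); first exact/nbhs_entourage/entourage_inv.
by move=> x /xsectionP.
Qed.

End FreeGroupInvariants.

(** Equality of cardinals is expressed as having the same upper bounds [K]; a product of infinite
    cardinals is bounded exactly when both factors are. *)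
Theorem theorem4p16 (X : uniformType) (c : NAclass) (G : topGroup) (i : X -> G) :
  hausdorff_space X -> nonarch_uniform X -> is_free_group c i ->
  (* (1) chi(G) = w(U) and w(G) = w(U) * l(U) *)
  ((forall (Z : Type) (K : set Z), character_le G K <-> uweight_le X K) /\
   (forall (Z : Type) (K : set Z),
      weight_le G K <-> (uweight_le X K /\ ulind_le X K))) /\
  (* (2) *)
  (forall (R : realType) (d : X -> X -> R),
     ultrametric d -> metric_induces_uniformity d ->
     ultra_normable G R /\
     (forall (Z : Type) (K : set Z), weight_le G K <-> weight_le X K)).
Proof.
move=> _ naX Gfree; split.
  by split=> Z K; [exact: (free_character Gfree)|exact: (free_weight Gfree)].
move=> R d _ d_unif; split; last by move=> Z K; exact: (free_weight_metric Gfree naX K d_unif).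
by exists (free_norm i d); split; [exact: (free_norm_ultra Gfree d_unif)|exact: (free_norm_topology Gfree d_unif)].
Qed.
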